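(* Let $(X,\|\cdot\|)$ be a Banach space and let $f,g:X\to\mathbb{R}\cup\{+\infty\}$ be proper, convex and lower semicontinuous. If $\partial g(x)\subset\partial f(x)$ for all $x\in X$, then there is a constant $c\in\mathbb{R}$ such that $f(x)=g(x)+c$ for all $x\in X$.
   Context: For a convex $f:X\to\mathbb{R}\cup\{+\infty\}$ and $x_0\in\operatorname{dom} f:=\{x:f(x)<+\infty\}$, the subdifferential is $\partial f(x_0):=\{p\in X^*:\ p(x-x_0)\le f(x)-f(x_0)\ \forall x\in X\}$, and $\partial f(x_0):=\varnothing$ if $x_0\notin\operatorname{dom} f$. *)

(* Defs.v *)
From HB Require Import structures.
From mathcomp Require Import all_boot all_order all_algebra.
From mathcomp Require Import all_classical all_reals all_analysis.
Set Implicit Arguments. Unset Strict Implicit. Unset Printing Implicit Defensive.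
Import Order.TTheory GRing.Theory Num.Theory.
Import numFieldNormedType.Exports.
Local Open Scope classical_set_scope.
Local Open Scope ring_scope.

(* Functions X -> R ∪ {+oo} are modelled as X -> \bar R that never take -oo. *)

Definition edom {R : realType} {X : Type} (f : X -> \bar R) : set X :=
  [set x | (f x < +oo)%E].

Definition proper_fun {R : realType} {X : Type} (f : X -> \bar R) : Prop :=
  (forall x, f x != -oo%E) /\ (exists x, (f x < +oo)%E).

(* convexity with the convention t * (+oo) = +oo for t > 0 *)
Definition econvex {R : realType} {X : lmodType R} (f : X -> \bar R) : Prop :=
  forall (x y : X) (t : R), 0 < t -> t < 1 ->
    (f (t *: x + (1 - t) *: y)%R <= t%:E * f x + (1 - t)%:E * f y)%E.

Definition dual_elt {R : realType} {X : normedModType R} (p : X -> R) : Prop :=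
  (forall x y, p (x + y) = p x + p y) /\
  (forall (a : R) x, p (a *: x) = a * p x) /\
  continuous p.

Definition subdiff {R : realType} {X : normedModType R} (f : X -> \bar R) (x0 : X)
  : set (X -> R) :=
  [set p | dual_elt p /\ (f x0 < +oo)%E /\
     forall x, ((p (x - x0)%R)%:E <= f x - f x0)%E].

(* Main.v *)
(* It suffices that increments of f dominate increments of g between points
   where both are finite: on the domain of the subdifferential of g the
   inequality can be reversed, so f - g is a constant there, and graphical
   density of that domain (Ekeland's principle) together with lower
   semicontinuity of f gives the claim everywhere. For the increments, cut the
   segment [a, b] into n equal pieces. Minimising g plus a Lipschitz convex
   function that decreases along the segment produces a subgradient of g,
   hence of f, from which the increment of g over each piece is at most the
   increment of f over the next piece. Summing telescopes, and n tends to
   infinity. *)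
Require Import Defs.
From HB Require Import structures.
From mathcomp Require Import all_boot all_order all_algebra.
From mathcomp Require Import all_classical all_reals all_analysis.
From mathcomp Require Import ring lra.
Import Order.TTheory GRing.Theory Num.Theory.
Import numFieldNormedType.Exports.
Local Open Scope classical_set_scope.
Local Open Scope ring_scope.

(** * Convex real functions, their infima and their linear minorants *)

Definition rconvex {R : realType} {X : lmodType R} (q : X -> R) : Prop :=
  forall (x y : X) (t : R), 0 < t -> t < 1 ->
    q (t *: x + (1 - t) *: y) <= t * q x + (1 - t) * q y.

(** The graph of [A] is convex in the product of [X] and the line. Below, [A x] collects all upper
    bounds of the candidate values at [x], so that [inf (A x)] is an infimum over hidden
    parameters. *)
Definition convex_rel {R : realType} {X : lmodType R} (A : X -> set R) : Prop :=
  forall (x y : X) (a b t : R), 0 < t -> t < 1 -> A x a -> A y b ->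
    A (t *: x + (1 - t) *: y) (t * a + (1 - t) * b).

(** Near-minimisers over [x] and over [y] combine into a candidate over the convex combination. This
    serves infima over chains, over directions, over decompositions and over points of a segment. *)
Lemma rconvex_inf (R : realType) (X : lmodType R) (A : X -> set R) :
  convex_rel A -> (forall x, has_inf (A x)) -> rconvex (fun x => inf (A x)).
Proof.
move=> cA iA x y t t0 t1; apply/ler_addgt0Pr => e e0.
have [a Aa lta] := inf_adherent e0 (iA x).
have [b Ab ltb] := inf_adherent e0 (iA y).
have [_ lbA] := iA (t *: x + (1 - t) *: y).
apply: (le_trans (ge_inf lbA (cA _ _ _ _ _ t0 t1 Aa Ab))).
have : t * a <= t * (inf (A x) + e) by rewrite ler_wpM2l// ltW.
have : (1 - t) * b <= (1 - t) * (inf (A y) + e).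
  by rewrite ler_wpM2l ?subr_ge0 // ltW.
lra.
Qed.

Lemma rconvexNr (R : realType) (X : lmodType R) (q : X -> R) x :
  rconvex q -> q 0 = 0 -> - q (- x) <= q x.
Proof.
move=> cq q0; have h0 : (0 : R) < 2^-1 by lra.
have h1 : (2^-1 : R) < 1 by lra.
have := cq x (- x) 2^-1 h0 h1.
have -> : 1 - 2^-1 = 2^-1 :> R by lra.
by rewrite scalerN subrr q0; lra.
Qed.

(* A convex function vanishing at 0 that is pointwise minimal among those is
   linear: compare it with its rescalings and with its directional infima. *)
Lemma hahn_banach_convex (R : realType) (X : lmodType R) (k : X -> R) :
  rconvex k -> k 0 = 0 ->
  exists p : X -> R, [/\ forall x y, p (x + y) = p x + p y,
    forall (a : R) x, p (a *: x) = a * p x & forall x, p x <= k x].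
Proof.
move=> ck k0.
pose P := fun q : X -> R => [/\ rconvex q, q 0 = 0 & forall x, q x <= k x].
pose T := {q : X -> R | P q}.
(* The order is reversed, so a maximal element for Zorn is a pointwise minimal function. *)
pose below (s t : T) : bool := `[< forall x, sval t x <= sval s x >].
have [[q [cq q0 qk]] qmin] : exists t, forall s, below t s -> s = t.
  apply: Zorn => [t|r s t /asboolP rs /asboolP st|[s Ps] [t Pt] /asboolP st /asboolP ts|].
  - exact/asboolP.
  - by apply/asboolP => x; exact: le_trans (st x) (rs x).
  - have E : s = t by apply/funext => x; apply/eqP; rewrite eq_le ts st.
    by move: Ps Pt {st ts}; rewrite E => Ps Pt; rewrite (Prop_irrelevance Ps Pt).
  - move=> A totA; have [A0|/set0P[t0 At0]] := eqVneq A set0.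
      have Pk : P k by split.
      by exists (exist P k Pk) => s; rewrite A0.
    pose B x := [set a | exists2 t, A t & sval t x <= a].
    have iB x : has_inf (B x).
      split; first by exists (sval t0 x), t0.
      (* A bound uniform in the chain: [q x >= - q (- x) >= - k (- x)]. *)
      exists (- k (- x)) => a [[q [cq q0 qk]] /= _ qa].
      apply: le_trans qa; apply: le_trans (rconvexNr _ _ _ x cq q0).
      by rewrite lerN2.
    have Pinf : P (fun x => inf (B x)).
      split.
      - apply: rconvex_inf => // x y a b t t0' t1 [s As sa] [s' As' sb].
        (* The smaller of two members of the chain serves both points at once. *)
        suff [r Ar [rs rs']] : exists2 r, A r & (sval r x <= a) /\ (sval r y <= b).
          exists r => //; have [cr _ _] := svalP r.
          apply: (le_trans (cr _ _ _ t0' t1)).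
          by rewrite lerD// ler_wpM2l// ?subr_ge0 ltW.
        have [/asboolP|/asboolP] := totA _ _ As As' => ss'.
          by exists s' => //; split=> //; exact: le_trans (ss' x) _.
        by exists s => //; split=> //; exact: le_trans (ss' y) _.
      - apply/eqP; rewrite eq_le; apply/andP; split.
          apply: ge_inf; first by have [] := iB 0.
          by exists t0 => //; have [_ -> _] := svalP t0.
        apply: lb_le_inf; first by have [] := iB 0.
        by move=> a [t At]; have [_ -> _] := svalP t.
      - move=> x; apply: (@le_trans _ _ (sval t0 x)).
          by apply: ge_inf; [have [] := iB x|exists t0].
        by have [_ _] := svalP t0.
    exists (exist P _ Pinf) => s As; apply/asboolP => x /=.
    by apply: ge_inf; [have [] := iB x|exists s].
have {}qmin q' : rconvex q' -> q' 0 = 0 -> (forall x, q' x <= q x) -> q' = q.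
  move=> cq' q'0 q'q.
  have Pq' : P q' by split=> // x; exact: le_trans (q'q x) (qk x).
  by apply: (congr1 sval (qmin (exist P _ Pq') _)); exact/asboolP.
(* Convexity between [y] and 0 puts the rescaling [a^-1 * q (a *: y)] below [q]; minimality makes
   them equal. *)
have qZ1 (a : R) x : 0 < a -> a < 1 -> q (a *: x) = a * q x.
  move=> a0 a1; have an0 : a != 0 by rewrite gt_eqF.
  suff /(congr1 (fun r => a * r x)) <- : (fun x => a^-1 * q (a *: x)) = q.
    by rewrite mulrA mulfV// mul1r.
  apply: qmin => [y z t t0 t1||y].
  - rewrite scalerDr !scalerA [a * t]mulrC [a * (1 - t)]mulrC -!scalerA.
    have := cq (a *: y) (a *: z) t t0 t1.
    by rewrite -(ler_pM2l (x := a^-1)) ?invr_gt0//; lra.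
  - by rewrite scaler0 q0 mulr0.
  - have := cq y 0 a a0 a1; rewrite scaler0 addr0 q0 mulr0 addr0.
    by rewrite ler_pdivrMl.
have qZp (a : R) x : 0 < a -> q (a *: x) = a * q x.
  move=> a0; have an0 : a != 0 by rewrite gt_eqF.
  have [a1|a1|->] := ltgtP a 1; [exact: qZ1| |by rewrite scale1r mul1r].
  have := qZ1 a^-1 (a *: x); rewrite scalerA mulVf// scale1r invr_gt0 => ->//.
    by rewrite mulrA mulfV// mul1r.
  by rewrite invf_lt1.
have qD x y : q (x + y) <= q x + q y.
  have h0 : (0 : R) < 2^-1 by lra.
  have h1 : (2^-1 : R) < 1 by lra.
  have := cq (2 *: x) (2 *: y) 2^-1 h0 h1.
  have -> : 1 - 2^-1 = 2^-1 :> R by lra.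
  by rewrite !qZp// !scalerA mulVf// !scale1r; lra.
have qN v : q (- v) = - q v.
  apply/eqP; rewrite eq_le; apply/andP; split; last first.
    by have := rconvexNr _ _ _ (- v) cq q0; rewrite opprK.
  (* The infimum along the ray in direction [v] lies below [q] (take [t = 0]), hence equals [q]; at
     [- v] with [t = 1] this reads [q (- v) <= - q v]. *)
  pose B (x : X) := [set a : R | exists2 t : R, 0 <= t & q (x + t *: v) - t * q v <= a].
  have qZn (t : R) : 0 <= t -> q (t *: v) = t * q v.
    by rewrite le_eqVlt => /predU1P[<-|/qZp//]; rewrite scale0r mul0r.
  have iB x : has_inf (B x).
    split; first by exists (q (x + 0 *: v) - 0 * q v), 0.
    exists (- q (- x)) => a [t t0]; apply: le_trans.
    have := qD (x + t *: v) (- x); rewrite addrAC subrr add0r qZn//; lra.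
  have qBq x : inf (B x) <= q x.
    apply: ge_inf; first by have [] := iB x.
    by exists 0 => //; rewrite scale0r mul0r addr0 subr0.
  have Bq : (fun x => inf (B x)) = q.
    apply: qmin => //.
      apply: rconvex_inf => // x y a b t t0 t1 [s s0 sa] [r r0 rb].
      have t1' : 0 <= 1 - t by rewrite subr_ge0 ltW.
      exists (t * s + (1 - t) * r).
        by rewrite addr_ge0 ?mulr_ge0// ?ltW.
      have -> : t *: x + (1 - t) *: y + (t * s + (1 - t) * r) *: v =
                t *: (x + s *: v) + (1 - t) *: (y + r *: v).
        by rewrite (scalerDl v) !scalerDr !scalerA addrACA.
      have := cq (x + s *: v) (y + r *: v) t t0 t1.
      have : t * (q (x + s *: v) - s * q v) <= t * a by rewrite ler_wpM2l// ltW.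
      have : (1 - t) * (q (y + r *: v) - r * q v) <= (1 - t) * b.
        by rewrite ler_wpM2l.
      lra.
    apply/eqP; rewrite eq_le -{1}q0 qBq/=.
    apply: lb_le_inf; first by have [] := iB 0.
    by move=> a [t t0]; rewrite add0r qZn// subrr.
  rewrite -{1}Bq; apply: ge_inf; first by have [] := iB (- v).
  by exists 1 => //; rewrite scale1r addNr q0 mul1r sub0r.
exists q; split => // [x y|a x].
  apply/eqP; rewrite eq_le qD/=.
  by have := qD (- x) (- y); rewrite -opprD !qN; lra.
have [a0|a0|->] := ltgtP a 0; [|exact: qZp|by rewrite scale0r q0 mul0r].
by rewrite -[a in LHS]opprK scaleNr qN qZp ?oppr_gt0// mulNr opprK.
Qed.

(** * Extended-valued convexity and lower semicontinuity *)

Lemma econvex_le (R : realType) (X : lmodType R) (f : X -> \bar R) (x y : X)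
    (a b t : R) : econvex f -> 0 < t -> t <= 1 ->
  (f x <= a%:E)%E -> (f y <= b%:E)%E ->
  (f (t *: x + (1 - t) *: y)%R <= (t * a + (1 - t) * b)%:E)%E.
Proof.
move=> cf t0; rewrite le_eqVlt => /predU1P[->|t1] fxa fyb.
  by rewrite subrr scale1r scale0r addr0 mul1r mul0r addr0.
apply: (le_trans (cf _ _ _ t0 t1)).
by rewrite (EFinD (t * a)) !EFinM leeD// lee_pmul2l// lte_fin subr_gt0.
Qed.

Lemma lte_EFin_between (R : realType) (r : R) (u : \bar R) :
  (r%:E < u)%E -> exists2 s, r < s & (s%:E < u)%E.
Proof.
case: u => [v| |]//=; last by exists (r + 1); rewrite ?ltry//; lra.
by rewrite lte_fin => rv; exists ((r + v) / 2); rewrite ?lte_fin; lra.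
Qed.

(** The epigraph is closed; a single [e] measures both the distance and the excess in value. *)
Lemma lower_semicontinuous_le (R : realType) (X : normedModType R)
    (F : X -> \bar R) (x : X) (r : R) : lower_semicontinuous F ->
  (forall e : R, 0 < e -> exists2 y, `|x - y| < e & (F y <= (r + e)%:E)%E) ->
  (F x <= r%:E)%E.
Proof.
move=> lF Fr; rewrite leNgt; apply/negP => rFx.
have [s rs sFx] := lte_EFin_between _ _ _ rFx.
have [V /nbhs_ballP[d /= d0 dV] VF] := lF _ _ sFx.
have e0 : 0 < Num.min d (s - r) by rewrite lt_min d0 subr_gt0.
have [y xy Fy] := Fr _ e0.
have : V y.
  by apply: dV; rewrite -ball_normE /= (lt_le_trans xy)// ge_min lexx.
move/VF => /lt_le_trans /(_ Fy); rewrite lte_fin ltNge => /negP; apply.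
have : Num.min d (s - r) <= s - r by rewrite ge_min lexx orbT.
lra.
Qed.

Lemma lower_semicontinuousD_lipschitz (R : realType) (X : normedModType R)
    (g : X -> \bar R) (h : X -> R) (K : R) : lower_semicontinuous g ->
  (forall y z, h y <= h z + K * `|y - z|) ->
  lower_semicontinuous (fun x => g x + (h x)%:E)%E.
Proof.
move=> lg hK x a; rewrite -lteBlDr// -EFinB => agx.
have [s rs sgx] := lte_EFin_between _ _ _ agx.
have [V Vx Vs] := lg _ _ sgx.
have K0 : 0 < `|K| + 1 by rewrite ltr_wpDl.
(* Within this radius [h] drops by less than the gap [s - (a - h x)]; [K] may be negative, hence the
   absolute value. *)
have d0 : 0 < (s - (a - h x)) / (`|K| + 1) by rewrite divr_gt0// subr_gt0.
exists (V `&` ball x ((s - (a - h x)) / (`|K| + 1))).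
  by apply: filterI => //; exact: nbhsx_ballx.
move=> y [/Vs sgy]; rewrite -ball_normE /= ltr_pdivlMr// => xy.
rewrite -lteBlDr// -EFinB; apply: lt_trans sgy; rewrite lte_fin.
have := hK x y; have := ler_norm K; have := normr_ge0 (x - y).
nra.
Qed.

(** * Ekeland's variational principle *)

(** Each step achieves at least half of the decrease available in the slice [S x]. Values converge
    to [L], so the points form a Cauchy sequence. A [y] violating the claim at the limit would lie
    in every slice, and the halving rule would then give [L <= phi y]. *)
Lemma ekeland (R : realType) (X : completeNormedModType R) (F : X -> \bar R)
    (a : X) (m e : R) :
  lower_semicontinuous F -> (forall x, m%:E <= F x)%E -> (F a < +oo)%E ->
  0 < e ->
  exists2 x, (F x <= F a)%E & forall y, (F x <= F y + (e * `|y - x|)%:E)%E.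
Proof.
move=> lF mF Fa e0.
have tri (x y z : X) : e * `|x - z| <= e * `|x - y| + e * `|y - z|.
  by rewrite -mulrDr ler_wpM2l ?ler_distD// ltW.
pose phi x := fine (F x).
have phiE x : (F x < +oo)%E -> F x = (phi x)%:E.
  by move=> Fx; rewrite /phi fineK// fin_real// Fx andbT (lt_le_trans _ (mF x))// ltNyr.
have mphi x : (F x < +oo)%E -> m <= phi x.
  by move=> Fx; have := mF x; rewrite phiE// lee_fin.
pose S x := [set y | (F y < +oo)%E /\ phi y + e * `|y - x| <= phi x].
(* The implication makes [next] total, as dependent choice requires; where [F] is infinite the
   successor is arbitrary. *)
pose next x y := (F x < +oo)%E -> S x y /\ forall z, S x z -> 2 * phi y <= phi x + phi z.
have nextP x : {y | next x y}.
  apply: cid; have [Fx|nFx] := pselect (F x < +oo)%E; last by exists x.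
  have Sx : S x x by split => //; rewrite subrr normr0 mulr0 addr0.
  have iS : has_inf (phi @` S x).
    by split; [exists (phi x), x|exists m => _ [z [Fz _] <-]; exact: mphi].
  have [/eqP E|ne] := boolP (phi x == inf (phi @` S x)).
    exists x => _; split=> // z Sz.
    have : phi x <= phi z by rewrite E; apply: ge_inf; [case: iS|exists z].
    lra.
  have ilt : inf (phi @` S x) < phi x.
    by rewrite lt_neqAle eq_sym ne/=; apply: ge_inf; [case: iS|exists x].
  have d0 : 0 < (phi x - inf (phi @` S x)) / 2 by rewrite divr_gt0// subr_gt0.
  have [_ [y Sy <-] ylt] := inf_adherent d0 iS.
  exists y => _; split=> // z Sz.
  have : inf (phi @` S x) <= phi z by apply: ge_inf; [case: iS|exists z].
  lra.
have [u [u0 unext]] := dependent_choice nextP a.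
have Fu n : (F (u n) < +oo)%E.
  by elim: n => [|n IH]; [rewrite u0|have [[]] := unext n IH].
have Su n k : S (u n) (u (n + k)%N).
  elim: k => [|k [_ IH]].
    by rewrite addn0; split=> //; rewrite subrr normr0 mulr0 addr0.
  split=> //; have [[_ +] _] := unext _ (Fu (n + k)%N); rewrite -addnS => nk.
  have := tri (u (n + k.+1)%N) (u (n + k)%N) (u n); lra.
pose L := inf (range (phi \o u)).
have iL : has_inf (range (phi \o u)).
  by split; [exists (phi (u 0)), 0|exists m => _ [n _ <-]; exact: mphi].
have Lu n : L <= phi (u n) by apply: ge_inf; [case: iL|exists n].
have uL d : 0 < d -> exists n, phi (u n) < L + d.
  by move=> d0; have [_ [n _ <-] ?] := inf_adherent d0 iL; exists n.
have cu : cvg (u n @[n --> \oo]).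
  apply/cauchy_cvgP; apply: cauchy_exP => d d0.
  have [n nL] := uL (e * d) (mulr_gt0 e0 d0).
  exists (u n); exists n => // k /= nk; rewrite -ball_normE /= distrC.
  have [_] := Su n (k - n)%N; rewrite subnKC// => Snk.
  by rewrite -(ltr_pM2l e0); have := Lu k; lra.
have [x /cvgrPdist_lt ux] := (cvg_ex _).1 cu.
(* The slice inequality passes to the limit by lower semicontinuity; the radius keeps both the
   distance and [e] times it below [d]. *)
have Fx n : (F x <= (phi (u n) - e * `|x - u n|)%:E)%E.
  apply: (lower_semicontinuous_le _ _ _ _ _ lF) => d d0.
  have d1 : 0 < Num.min d (d / e) by rewrite lt_min d0 divr_gt0.
  have [N _ Nu] := ux _ d1.
  have /= := Nu (n + N)%N (leq_addl n N); rewrite lt_min => /andP[xd].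
  rewrite ltr_pdivlMr// mulrC => xde; exists (u (n + N)%N) => //.
  rewrite phiE// lee_fin.
  have [_] := Su n N.
  have := tri x (u (n + N)%N) (u n); lra.
have Fxfin : (F x < +oo)%E by apply: le_lt_trans (Fx 0%N) _; exact: ltry.
exists x.
  apply: le_trans (Fx 0%N) _; rewrite u0 phiE// lee_fin gerBl mulr_ge0//.
  exact: ltW.
move=> y; rewrite leNgt; apply/negP => yx.
have Fy : (F y < +oo)%E.
  by rewrite ltey; apply: contraTneq yx => ->; rewrite addye// -leNgt leey.
move: yx; rewrite (phiE x)// (phiE y)// -EFinD lte_fin => yx.
have phix n : phi x <= phi (u n) - e * `|x - u n|.
  by have := Fx n; rewrite phiE// lee_fin.
have Sy n : S (u n) y.
  split=> //; have := phix n.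
  have := tri y x (u n); lra.
have Ly : L <= phi y.
  apply/ler_addgt0Pr => d d0; have [n nL] := uL _ d0.
  have [_ /(_ _ (Sy n))] := unext n (Fu n); have := Lu n.+1; lra.
have xL : phi x <= L.
  apply: lb_le_inf; first by case: iL.
  move=> _ [n _ <-] /=; have := phix n.
  have : 0 <= e * `|x - u n| by rewrite mulr_ge0// ltW.
  lra.
have : 0 <= e * `|y - x| by rewrite mulr_ge0// ltW.
lra.
Qed.

(** * Subgradients from minimising a perturbed convex function *)

Lemma continuous_of_le_norm (R : realType) (X : normedModType R) (p : X -> R)
    (K : R) :
  (forall x y, p (x + y) = p x + p y) ->
  (forall (a : R) x, p (a *: x) = a * p x) ->
  (forall x, p x <= K * `|x|) -> continuous p.
Proof.
move=> pD pZ pK x; apply/cvgrPdist_lt => e e0.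
have K0 : 0 < `|K| + 1 by rewrite ltr_wpDl.
have pN y : p (- y) = - p y by rewrite -scaleN1r pZ mulN1r.
have d0 : 0 < e / (`|K| + 1) by rewrite divr_gt0.
near=> y; rewrite -pN -pD.
have : `|x - y| < e / (`|K| + 1).
  by near: y; have := nbhsx_ballx x _ d0; rewrite -ball_normE.
rewrite ltr_pdivlMr// ltr_norml => xy.
have := pK (x - y); have := pK (- (x - y)); rewrite normrN pN.
have := ler_norm K; have := normr_ge0 (x - y) => n0 KK p1 p2.
have KM : K * `|x - y| <= `|x - y| * `|K| by rewrite mulrC ler_wpM2l.
by apply/andP; split; nra.
Unshelve. all: by end_near. Qed.

(* The linear form is obtained by Hahn-Banach below the infimal convolution of
   [g (x + _) - g x] and the reflection of [h (x + _) - h x]. *)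
Lemma subdiff_of_min_sum (R : realType) (X : normedModType R)
    (g : X -> \bar R) (h : X -> R) (x : X) (c K : R) :
  econvex g -> g x = c%:E -> rconvex h ->
  (forall y z, h y <= h z + K * `|y - z|) ->
  (forall y r, (g y <= r%:E)%E -> c + h x <= r + h y) ->
  exists2 p, subdiff g x p & forall y, h x - h y <= p (y - x).
Proof.
move=> cg gx ch hK gh.
pose A (w : X) := [set a : R | exists y r,
  (g y <= r%:E)%E /\ r + h (y - w) - c - h x <= a].
have Ax w : A w (h (x - w) - h x).
  by exists x, c; rewrite gx lexx; split=> //; lra.
(* Minimality of [g + h] at [x] and the Lipschitz bound on [h] keep the convolution finite and, with
   [Ax], make it vanish at 0. *)
have Alb w : lbound (A w) (- (K * `|w|)).
  move=> a [y [r [gy]]]; apply: le_trans.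
  have := gh _ _ gy; have := hK y (y - w).
  by rewrite opprD opprK addNKr; lra.
have iA w : has_inf (A w) by split; [eexists; exact: Ax|eexists; exact: Alb].
have ck : rconvex (fun w => inf (A w)).
  apply: rconvex_inf => // w z a b t t0 t1 [y [r [gy ra]]] [y' [r' [gy' rb]]].
  exists (t *: y + (1 - t) *: y'), (t * r + (1 - t) * r').
  split; first by apply: econvex_le => //; exact: ltW.
  have -> : t *: y + (1 - t) *: y' - (t *: w + (1 - t) *: z) =
            t *: (y - w) + (1 - t) *: (y' - z).
    by rewrite !scalerBr opprD addrACA.
  have := ch (y - w) (y' - z) t t0 t1.
  have : t * (r + h (y - w) - c - h x) <= t * a by rewrite ler_wpM2l// ltW.
  have : (1 - t) * (r' + h (y' - z) - c - h x) <= (1 - t) * b.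
    by rewrite ler_wpM2l// subr_ge0 ltW.
  lra.
have [] := @hahn_banach_convex R X _ ck.
  apply/eqP; rewrite eq_le; apply/andP; split.
    apply: ge_inf; first by have [] := iA 0.
    by have := Ax 0; rewrite subr0 subrr.
  apply: lb_le_inf; first by have [] := iA 0.
  by have := Alb 0; rewrite normr0 mulr0 oppr0.
move=> p [pD pZ pk].
have pN y : p (- y) = - p y by rewrite -scaleN1r pZ mulN1r.
have pA w a : A w a -> p w <= a.
  by move=> Aa; apply: le_trans (pk w) _; apply: ge_inf => //; have [] := iA w.
exists p; last first.
  move=> y; have := pA _ _ (Ax (x - y)).
  by rewrite opprB addrCA subrr addr0 -opprB pN; lra.
split; last split.
- split=> //; split=> //; apply: (@continuous_of_le_norm _ _ _ K) => // w.
  apply: le_trans (pA _ _ (Ax w)) _.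
  by have := hK (x - w) x; rewrite addrAC subrr add0r normrN; lra.
- by rewrite gx ltry.
- move=> y; rewrite gx; case gy : (g y) => [r| |] /=.
  (* With [w = y - x] the two [h] terms cancel, leaving [r - c]. *)
  + rewrite -EFinB lee_fin; apply: pA; exists y, r; split; first by rewrite gy.
    by rewrite opprB addrCA subrr addr0; lra.
  + by rewrite addye// leey.
  + exfalso; have /(gh y) : (g y <= (c + h x - h y - 1)%:E)%E by rewrite gy leNye.
    lra.
Qed.

Lemma rconvexD (R : realType) (X : lmodType R) (h k : X -> R) :
  rconvex h -> rconvex k -> rconvex (fun x => h x + k x).
Proof.
by move=> ch ck x y t t0 t1; have := ch x y t t0 t1; have := ck x y t t0 t1; lra.
Qed.

Lemma rconvex_norm (R : realType) (X : normedModType R) (a : X) (K : R) :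
  0 <= K -> rconvex (fun x => K * `|x - a|).
Proof.
move=> K0 x y t t0 t1.
have -> : t *: x + (1 - t) *: y - a = t *: (x - a) + (1 - t) *: (y - a).
  rewrite !scalerBr addrACA -opprD -scalerDl.
  by rewrite addrCA subrr addr0 scale1r.
have := ler_normD (t *: (x - a)) ((1 - t) *: (y - a)).
rewrite !normrZ gtr0_norm// gtr0_norm ?subr_gt0// => /(ler_wpM2l K0); lra.
Qed.

(** Near [a], semicontinuity keeps [g] above [c - 1]. A far [y] with too low a value would, by
    convexity, pull [g] below that level at the point of the segment at distance [d / 2] from
    [a]. *)
Lemma econvex_lower_bound (R : realType) (X : normedModType R)
    (g : X -> \bar R) (a : X) (c : R) :
  econvex g -> lower_semicontinuous g -> g a = c%:E ->
  exists2 M, 0 <= M & forall y r, (g y <= r%:E)%E -> c - 1 - M * `|y - a| <= r.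
Proof.
move=> cg lg ga.
have [|V /nbhs_ballP[d /= d0 dV] Vg] := lg a (c - 1).
  by rewrite ga lte_fin; lra.
have near_a y r : `|a - y| < d -> (g y <= r%:E)%E -> c - 1 < r.
  move=> yd gyr; rewrite -lte_fin; apply: lt_le_trans gyr; apply: Vg; apply: dV.
  by rewrite -ball_normE.
exists (2 / d); first by rewrite divr_ge0// ltW.
move=> y r gyr; have n0 := normr_ge0 (y - a).
have dn0 : d != 0 by rewrite gt_eqF.
have M0 : 0 <= 2 / d * `|y - a| by rewrite mulr_ge0// divr_ge0// ltW.
have [yd|dy] := ltP `|a - y| d; first by have := near_a _ _ yd gyr; lra.
rewrite distrC in dy; have ya0 : 0 < `|y - a| by exact: lt_le_trans dy.
pose t := d / (2 * `|y - a|).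
have t0 : 0 < t by rewrite divr_gt0// mulr_gt0.
have t1 : t <= 1 by rewrite ler_pdivrMr ?mulr_gt0//; lra.
have := near_a (t *: y + (1 - t) *: a) (t * r + (1 - t) * c).
have -> : a - (t *: y + (1 - t) *: a) = - (t *: (y - a)).
  by rewrite scalerBl scale1r scalerBr opprD opprB addrCA (addrC a) subrK opprB addrC.
rewrite normrN normrZ gtr0_norm//.
have -> : t * `|y - a| = d / 2.
  by rewrite /t; field; rewrite gt_eqF.
have -> : d / 2 < d by lra.
move=> /(_ isT).
rewrite econvex_le ?ga// => /(_ isT) tr.
have tM : t * (2 / d * `|y - a|) = 1.
  by rewrite /t; field; rewrite dn0 gt_eqF.
rewrite -(ler_pM2l t0); lra.
Qed.

(** The Ekeland error [e * |y - x|] is itself convex and Lipschitz; added to [h], it turns the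
    approximate minimiser into an exact one. *)
Lemma perturbed_subdiff (R : realType) (X : completeNormedModType R)
    (g : X -> \bar R) (h : X -> R) (a : X) (c K m e : R) :
  econvex g -> lower_semicontinuous g -> g a = c%:E ->
  rconvex h -> (forall y z, h y <= h z + K * `|y - z|) ->
  (forall y r, (g y <= r%:E)%E -> m <= r + h y) -> 0 < e ->
  exists x b p, [/\ g x = b%:E, b + h x <= c + h a, subdiff g x p
    & forall y, h x - h y - e * `|y - x| <= p (y - x)].
Proof.
move=> cg lg ga ch hK gm e0.
have [||x] := @ekeland R X (fun x => g x + (h x)%:E)%E a m e
  (lower_semicontinuousD_lipschitz _ _ _ _ _ lg hK) _ _ e0.
- move=> x; case gx : (g x) => [r| |] /=.
  + by rewrite -EFinD lee_fin; apply: gm; rewrite gx.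
  + by rewrite addye// leey.
  + exfalso; have /(gm x) : (g x <= (m - h x - 1)%:E)%E by rewrite gx leNye.
    lra.
- by rewrite ga -EFinD ltry.
rewrite ga; case gx : (g x) => [b| |] //=; last first.
  exfalso; have /(gm x) : (g x <= (m - h x - 1)%:E)%E by rewrite gx leNye.
  lra.
rewrite -!EFinD lee_fin => ba xmin.
have ch' : rconvex (fun y => h y + e * `|y - x|).
  by apply: rconvexD => //; apply: rconvex_norm; exact: ltW.
have hK' y z : h y + e * `|y - x| <= h z + e * `|z - x| + (K + e) * `|y - z|.
  have := hK y z; have := ler_distD z y x.
  by move/(ler_wpM2l (ltW e0)); lra.
have [|p px ph] := subdiff_of_min_sum _ _ _ _ _ _ _ cg gx ch' hK'.
  move=> y r gyr; rewrite subrr normr0 mulr0 addr0 -lee_fin EFinD.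
  apply: (le_trans (xmin y)); rewrite addrA [(r + _ + _)%:E]EFinD leeD2r//.
  by rewrite EFinD leeD2r.
exists x, b, p; split=> // y; have := ph y.
by rewrite subrr normr0 mulr0 addr0; lra.
Qed.

Lemma subdiff_dom_dense (R : realType) (X : completeNormedModType R)
    (g : X -> \bar R) (a : X) (c e : R) :
  econvex g -> lower_semicontinuous g -> g a = c%:E -> 0 < e ->
  exists x p, [/\ subdiff g x p, `|a - x| < e & (g x <= c%:E)%E].
Proof.
move=> cg lg ga e0; have [M M0 gM] := econvex_lower_bound _ _ _ _ _ cg lg ga.
have K0 : 0 <= M + 2 / e by rewrite addr_ge0// divr_ge0// ltW.
(* The slope [M] offsets the possible decay of [g], and the extra [2 / e] confines the minimiser to
   distance [e / 2] from [a]. *)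
have [|y r gyr|x [b [p [gx xa px _]]]] := @perturbed_subdiff R X g
  (fun x => (M + 2 / e) * `|x - a|) a c (M + 2 / e) (c - 1) 1 cg lg ga
  (rconvex_norm _ _ _ _ K0) _ _ ltr01.
- move=> y z; have := ler_distD z y a.
  by move/(ler_wpM2l K0); lra.
- have := gM _ _ gyr; have : 0 <= 2 / e * `|y - a|.
    by rewrite mulr_ge0// divr_ge0// ltW.
  lra.
exists x, p; move: xa; rewrite subrr normr0 mulr0 addr0 => xa; split => //.
  have : 2 / e * `|x - a| <= 1.
    by have := gM x b; rewrite gx lexx => /(_ isT); lra.
  by rewrite mulrAC ler_pdivrMr// distrC; lra.
rewrite gx lee_fin; have : 0 <= (M + 2 / e) * `|x - a| by rewrite mulr_ge0.
lra.
Qed.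

(** * Comparison of increments along a segment *)

Lemma scaler_comb (R : realType) (X : lmodType R) (a w y : X) (l s t : R) :
  l *: (a + (t *: w + y)) + (1 - l) *: (a + s *: w) =
  a + ((l * t + (1 - l) * s) *: w + l *: y).
Proof.
rewrite !scalerDr !scalerA addrACA -scalerDl [l + _]addrC subrK scale1r.
by rewrite addrAC -scalerDl.
Qed.

(* The Lipschitz convex perturbation [h] is the largest one that decreases with
   slope [d] along the segment: minimising [g + h] forces a subgradient of [g]
   near that segment to grow at rate at least [d] towards [a + 2 w]. *)
Lemma increment_le (R : realType) (X : completeNormedModType R)
    (f g : X -> \bar R) (a w : X) (al b1 b2 : R) :
  (forall x, f x != -oo%E) -> econvex f -> lower_semicontinuous f ->
  econvex g -> lower_semicontinuous g ->
  (forall x, subdiff g x `<=` subdiff f x) ->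
  g a = al%:E -> f (a + w) = b1%:E -> f (a + 2 *: w) = b2%:E ->
  (g (a + w)%R <= (al + b2 - b1)%:E)%E.
Proof.
move=> fN cf lf cg lg gf ga f1 f2; rewrite leNgt; apply/negP.
move=> /lte_EFin_between[s0 s0gt /lte_EFin_between[s ss0 sg]].
(* Here [d > b2 - b1], so the bound [f (a + w) <= b2 - d] is absurd. The room [s - s0] is spent
   later to show [t < 1]. *)
pose d := s0 - al.
have [V /nbhs_ballP[r /= r0 rV] Vs] := lg _ _ sg.
have gs x v : `|a + w - x| < r -> (g x <= v%:E)%E -> s < v.
  move=> xr gxv; rewrite -lte_fin; apply: lt_le_trans gxv; apply: Vs; apply: rV.
  by rewrite -ball_normE.
suff : (f (a + w)%R <= (b2 - d)%:E)%E by rewrite f1 lee_fin /d; lra.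
apply: (lower_semicontinuous_le _ _ _ _ _ lf) => e e0.
have [M M0 gM] := econvex_lower_bound _ _ _ _ _ cg lg ga.
pose eta := Num.min r e.
have eta0 : 0 < eta by rewrite lt_min r0.
have etar : eta <= r by rewrite ge_min lexx.
have etae : eta <= e by rewrite ge_min lexx orbT.
(* [al - C] bounds [g + h] from below, and the part [(C + 1) / eta] of the slope [K] forces the
   minimiser within [eta] of the segment. *)
pose C := 1 + M * (2 * `|w|) + 2 * `|d|.
have C0 : 0 <= C by rewrite !addr_ge0 ?mulr_ge0.
pose K := M + (C + 1) / eta.
have KM0 : 0 < (C + 1) / eta by rewrite divr_gt0// ltr_wpDl.
have K0 : 0 <= K by rewrite addr_ge0// ltW.
pose A (y : X) := [set v : R | exists t, [/\ 0 <= t, t <= 2 &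
  K * `|y - (a + t *: w)| - t * d <= v]].
have At y t : 0 <= t -> t <= 2 -> A y (K * `|y - (a + t *: w)| - t * d).
  by move=> t0 t2; exists t; split.
have td (t : R) : 0 <= t -> t <= 2 -> t * d <= 2 * `|d|.
  move=> t0 t2; apply: (@le_trans _ _ (t * `|d|)).
    by rewrite ler_wpM2l// ler_norm.
  by rewrite ler_wpM2r.
have iA y : has_inf (A y).
  split; first by exists (K * `|y - (a + 0 *: w)| - 0 * d); apply: At.
  exists (- (2 * `|d|)) => v [t [t0 t2]]; apply: le_trans.
  by have := td t t0 t2; have := mulr_ge0 K0 (normr_ge0 (y - (a + t *: w))); lra.
pose h y := inf (A y).
have hA y v : A y v -> h y <= v by move=> Av; apply: ge_inf => //; case: (iA y).
have ch : rconvex h.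
  apply: rconvex_inf => // x y u v t t0 t1 [p [p0 p2 pu]] [q [q0 q2 qv]].
  have t1' : 0 <= 1 - t by lra.
  exists (t * p + (1 - t) * q); split.
  - by rewrite addr_ge0 ?mulr_ge0// ?ltW.
  - have : t * p <= t * 2 by rewrite ler_wpM2l// ltW.
    have : (1 - t) * q <= (1 - t) * 2 by rewrite ler_wpM2l.
    lra.
  have -> : t *: x + (1 - t) *: y - (a + (t * p + (1 - t) * q) *: w) =
      t *: (x - (a + p *: w)) + (1 - t) *: (y - (a + q *: w)).
    rewrite !scalerBr addrACA -opprD; congr (_ - _).
    have := @scaler_comb R X a w 0 t q p.
    by rewrite !addr0 scaler0 addr0 => ->.
  have := ler_normD (t *: (x - (a + p *: w))) ((1 - t) *: (y - (a + q *: w))).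
  rewrite !normrZ gtr0_norm// (ger0_norm t1') => /(ler_wpM2l K0).
  have := ler_wpM2l (ltW t0) pu; have := ler_wpM2l t1' qv.
  lra.
have hK y z : h y <= h z + K * `|y - z|.
  rewrite -lerBlDr; apply: lb_le_inf; first by case: (iA z).
  move=> v [t [t0 t2]]; apply: le_trans; have := hA _ _ (At y t t0 t2).
  have := ler_distD z y (a + t *: w).
  by move=> /(ler_wpM2l K0); lra.
have gbelow y v t : (g y <= v%:E)%E -> 0 <= t -> t <= 2 ->
    al - C + (C + 1) / eta * `|y - (a + t *: w)| <=
    v + (K * `|y - (a + t *: w)| - t * d).
  move=> gyv t0 t2; have := gM _ _ gyv; have := td t t0 t2.
  have : `|y - a| <= `|y - (a + t *: w)| + 2 * `|w|.
    have := ler_distD (a + t *: w) y a.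
    rewrite [a + _ - a]addrAC subrr add0r normrZ ger0_norm//.
    have : t * `|w| <= 2 * `|w| by rewrite ler_wpM2r.
    lra.
  by move=> /(ler_wpM2l M0); rewrite /K /C; lra.
have gh y v : (g y <= v%:E)%E -> al - C <= v + h y.
  move=> gyv; rewrite -lerBlDl; apply: lb_le_inf; first by case: (iA y).
  move=> u [t [t0 t2]]; apply: le_trans; have := gbelow _ _ _ gyv t0 t2.
  have : 0 <= (C + 1) / eta * `|y - (a + t *: w)| by rewrite mulr_ge0// ltW.
  lra.
have N0 : 0 < e + 2 * `|w| by rewrite ltr_wpDr// mulr_ge0.
(* The distance from [x] to [a + 2 *: w] will be at most [e + 2 * |w|], so the Ekeland error there
   costs at most [e / 2]. *)
have e'0 : 0 < e / 2 / (e + 2 * `|w|) by rewrite !divr_gt0.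
have [x [b [p [gx bx px ph]]]] :=
  perturbed_subdiff _ _ _ _ _ _ _ _ _ cg lg ga ch hK gh e'0.
(* The slack 1 serves [yeta], [s - s0] serves [t < 1], and [e / 2] the final estimate [cb]. *)
pose e1 := Num.min 1 (Num.min (s - s0) (e / 2)).
have e10 : 0 < e1 by rewrite !lt_min ltr01 subr_gt0 ss0 divr_gt0.
have e11 : e1 <= 1 by rewrite ge_min lexx.
have e1s : e1 <= s - s0 by rewrite !ge_min lexx orbT.
have e1e : e1 <= e / 2 by rewrite !ge_min lexx !orbT.
have [v [t [t0 t2 tv]] vh] := inf_adherent e10 (iA x).
have ha : h a <= 0.
  by have := hA _ _ (At a 0 (lexx 0) (ltW (ltr0n _ 2))); rewrite scale0r addr0 subrr normr0; lra.
pose y := x - (a + t *: w).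
have xE : x = a + (t *: w + y) by rewrite addrA addrC subrK.
have hx : K * `|y| - t * d < h x + e1 by apply: le_lt_trans tv vh.
have yeta : `|y| < eta.
  have := gbelow x b t; rewrite gx lexx => /(_ isT t0 t2); rewrite -/y => blow.
  have : (C + 1) / eta * `|y| < C + 1 by lra.
  by rewrite mulrAC ltr_pdivrMr// ltr_pM2l// ltr_wpDl.
have Ky0 : 0 <= K * `|y| by rewrite mulr_ge0.
clearbody y.
(* Otherwise contracting [x] towards [a] by [t^-1] lands within [r] of [a + w], where [g > s].
   Convexity gives [b - al > t * (s - al)], while the choice of [x] gives
   [b - al < t * d + (s - s0)]. *)
have t1 : t < 1.
  rewrite ltNge; apply/negP => t1.
  have tp : 0 < t by exact: lt_le_trans t1.
  have tV1 : t^-1 <= 1 by rewrite invf_le1.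
  have tV0 : 0 < t^-1 by rewrite invr_gt0.
  have zE : t^-1 *: x + (1 - t^-1) *: a = a + (w + t^-1 *: y).
    have := scaler_comb _ _ a w y t^-1 0 t.
    by rewrite scale0r addr0 mulr0 addr0 mulVf ?gt_eqF// scale1r -xE.
  have zr : `|a + w - (t^-1 *: x + (1 - t^-1) *: a)| < r.
    rewrite zE addrA opprD addrA subrr add0r normrN normrZ gtr0_norm//.
    apply: lt_le_trans etar; apply: le_lt_trans yeta.
    by rewrite -[leRHS]mul1r ler_wpM2r.
  have := gs _ (t^-1 * b + (1 - t^-1) * al) zr.
  rewrite econvex_le ?gx ?ga// => /(_ isT).
  have -> : t^-1 * b + (1 - t^-1) * al = al + (b - al) / t by lra.
  rewrite -ltrBlDl ltr_pdivlMr// => sb.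
  have : 1 * (s - s0) <= t * (s - s0) by rewrite ler_wpM2r// subr_ge0 ltW.
  by move: hx bx ha; rewrite /d; lra.
have [_ [fx pf]] := gf _ _ px.
have := pf (a + 2 *: w); have := ph (a + 2 *: w).
have {fx}[c fxE] : exists c, f x = c%:E.
  by move: (fN x) fx; case: (f x) => // c; exists c.
rewrite fxE f2 -EFinB lee_fin => ph2 pf2.
(* The weight that brings the parameters [t] and 2 to 1; it also turns the gain [(2 - t) * d] into
   exactly [d]. *)
pose l := (2 - t)^-1.
have tt0 : 0 < 2 - t by lra.
have l0 : 0 < l by rewrite invr_gt0.
have l1 : l <= 1 by rewrite invf_le1//; lra.
have lt1 : l * (2 - t) = 1 by rewrite mulVf// gt_eqF.
exists (l *: x + (1 - l) *: (a + 2 *: w)).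
  rewrite {1}xE scaler_comb.
  have -> : l * t + (1 - l) * 2 = 1 by lra.
  have -> : a + w - (a + (1 *: w + l *: y)) = - (l *: y).
    by rewrite scale1r addrA opprD addrA subrr add0r.
  rewrite normrN normrZ gtr0_norm//; apply: lt_le_trans etae.
  by apply: le_lt_trans yeta; rewrite -[leRHS]mul1r ler_wpM2r.
have hb : h (a + 2 *: w) <= - (2 * d).
  have := hA _ _ (At (a + 2 *: w) 2 (ltW (ltr0n _ 2)) (lexx _)).
  by rewrite subrr normr0 mulr0 sub0r.
have xb : `|a + 2 *: w - x| <= e + 2 * `|w|.
  have -> : a + 2 *: w - x = (2 - t) *: w - y.
    by rewrite xE scalerBl opprD addrACA subrr add0r opprD addrA.
  apply: (le_trans (ler_normB _ _)); rewrite normrZ gtr0_norm//.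
  have : (2 - t) * `|w| <= 2 * `|w| by rewrite ler_wpM2r//; lra.
  lra.
have exb : e / 2 / (e + 2 * `|w|) * `|a + 2 *: w - x| <= e / 2.
  rewrite mulrAC ler_pdivrMr// ler_wpM2l//; lra.
have cb : c <= b2 - (2 - t) * d + e by lra.
apply: (@le_trans _ _ (l * c + (1 - l) * b2)%:E).
  by apply: econvex_le => //; rewrite ?fxE ?f2.
rewrite lee_fin.
have := ler_wpM2l (ltW l0) cb.
have : l * e <= e by rewrite -[leRHS]mul1r ler_wpM2r// ltW.
have : l * ((2 - t) * d) = d by rewrite mulrA lt1 mul1r.
lra.
Qed.

(** Telescoping compares [g] from [a] to [z N] with [f] from [z 1] to [b]. The shift by one piece is
    removed by lower semicontinuity of [g] at [b] and of [f] at [a]. *)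
Lemma increment_le_segment (R : realType) (X : completeNormedModType R)
    (f g : X -> \bar R) (a b : X) (ga fa fb : R) :
  (forall x, f x != -oo%E) -> econvex f -> lower_semicontinuous f ->
  (forall x, g x != -oo%E) -> econvex g -> lower_semicontinuous g ->
  (forall x, subdiff g x `<=` subdiff f x) ->
  g a = ga%:E -> f a = fa%:E -> f b = fb%:E ->
  (g b <= (ga + fb - fa)%:E)%E.
Proof.
move=> fN cf lf gN cg lg gf gaE faE fbE.
apply: (lower_semicontinuous_le _ _ _ _ _ lg) => e e0.
have [|V /nbhs_ballP[d /= d0 dV] Vf] := lf a (fa - e).
  by rewrite faE lte_fin; lra.
(* Pieces shorter than [d] keep [f (z 1)] above [fa - e]; shorter than [e], they put [z N] within
   [e] of [b]. *)
have m0 : 0 < Num.min d e by rewrite lt_min d0.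
pose v := b - a.
have [N Nv] : exists N : nat, `|v| / N.+1%:R < Num.min d e.
  exists (Num.bound (`|v| / Num.min d e)).
  rewrite ltr_pdivrMr// mulrC -ltr_pdivrMr//.
  apply: (lt_trans (archi_boundP _)); last by rewrite ltr_nat.
  by rewrite divr_ge0// ltW.
pose tau : R := N.+1%:R^-1.
have tau0 : 0 < tau by rewrite invr_gt0.
have tauN : N.+1%:R * tau = 1 by rewrite mulfV.
have vN : `|tau *: v| < Num.min d e.
  by rewrite normrZ gtr0_norm// mulrC.
pose z (i : nat) := a + (i%:R * tau) *: v.
have zS i : z i + tau *: v = z i.+1.
  by rewrite /z -addrA -scalerDl -natr1 mulrDl mul1r.
have zSS i : z i + 2 *: (tau *: v) = z i.+2.
  by rewrite scaler_nat mulr2n addrA !zS.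
have z0 : z 0 = a by rewrite /z mul0r scale0r addr0.
have zN : z N.+1 = b by rewrite /z tauN scale1r addrC subrK.
pose F i := fine (f (z i)).
have fz i : (0 < i <= N.+1)%N -> f (z i) = (F i)%:E.
  move=> /andP[i0 iN]; rewrite /F.
  have it0 : 0 < i%:R * tau by rewrite mulr_gt0// ltr0n.
  have it1 : i%:R * tau <= 1 by rewrite -[leRHS]tauN ler_pM2r// ler_nat.
  have : (f (z i) <= (i%:R * tau * fb + (1 - i%:R * tau) * fa)%:E)%E.
    have -> : z i = (i%:R * tau) *: b + (1 - i%:R * tau) *: a.
      by rewrite /z /v scalerBr scalerBl scale1r addrCA.
    by apply: econvex_le => //; rewrite ?faE ?fbE.
  by move: (fN (z i)); case: (f (z i)).
have gz i : (i <= N)%N -> (g (z i) <= (ga + F i.+1 - F 1)%:E)%E.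
  elim: i => [|i IH] iN; first by rewrite z0 gaE addrK.
  have := IH (ltnW iN); case gzE : (g (z i)) (gN (z i)) => [r| |]// _.
  rewrite lee_fin => rle.
  have := increment_le _ _ f g (z i) (tau *: v) r (F i.+1) (F i.+2)
    fN cf lf cg lg gf gzE.
  rewrite zS zSS => /(_ (fz _ _) (fz _ _)).
  rewrite !ltnS (ltnW iN) iN => /(_ isT isT) /le_trans; apply.
  by rewrite lee_fin; lra.
exists (z N).
  rewrite -zN -zS addrAC subrr add0r; apply: lt_le_trans vN _.
  by rewrite ge_min lexx orbT.
apply: le_trans (gz N (leqnn _)) _; rewrite lee_fin /F zN fbE /=.
have : fa - e < F 1.
  rewrite -lte_fin -fz//; apply: Vf; apply: dV.
  rewrite -ball_normE /= -(zS 0%N) z0 opprD addrA subrr add0r normrN.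
  by apply: lt_le_trans vN _; rewrite ge_min lexx.
by rewrite /F; lra.
Qed.

(** * From increments to a constant difference *)

Theorem theorem4p1 (R : realType) (X : completeNormedModType R)
    (f g : X -> \bar R) :
  proper_fun f -> econvex f -> lower_semicontinuous f ->
  proper_fun g -> econvex g -> lower_semicontinuous g ->
  (forall x : X, subdiff g x `<=` subdiff f x) ->
  exists c : R, forall x : X, f x = (g x + c%:E)%E.
Proof.
move=> [fN _] cf lf [gN [y0 gy0]] cg lg gf.
have gfin x : (g x < +oo)%E -> exists r, g x = r%:E.
  by move: (gN x); case: (g x) => // r; exists r.
have ffin x : (f x < +oo)%E -> exists r, f x = r%:E.
  by move: (fN x); case: (f x) => // r; exists r.
have dom x p : subdiff g x p -> exists r s, g x = r%:E /\ f x = s%:E.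
  move=> px; have [_ [/gfin[r gx] _]] := px.
  by have [_ [/ffin[s fx] _]] := gf _ _ px; exists r, s.
have incr a b ga fa fb := increment_le_segment _ _ f g a b ga fa fb
  fN cf lf gN cg lg gf.
have [r0 gy0E] := gfin _ gy0.
have [x0 [p0 [px0 _ _]]] := subdiff_dom_dense _ _ _ _ _ _ cg lg gy0E ltr01.
have [g0 [f0 [gx0 fx0]]] := dom _ _ px0.
exists (f0 - g0) => x; apply/eqP; rewrite eq_le; apply/andP; split; last first.
  (* The increment from [x0] to [x] gives [g x + c <= f x]. *)
  case fx : (f x) (fN x) => [s| |]// _; last by rewrite leey.
  have := incr _ _ _ _ _ gx0 fx0 fx.
  case: (g x) (gN x) => [r| |]// _; rewrite -EFinD !lee_fin; lra.
case gx : (g x) (gN x) => [r| |]// _; last by rewrite addye// leey.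
(* For the reverse bound, a nearby [y] with a subgradient has both values finite, so the increment
   can be taken from [y] back to [x0]; [g y <= g x] then carries the bound to [x]. *)
rewrite -EFinD; apply: (lower_semicontinuous_le _ _ _ _ _ lf) => e e0.
have [y [p [py xy gyr]]] := subdiff_dom_dense _ _ _ _ _ _ cg lg gx e0.
exists y => //; have [r' [s [gy fy]]] := dom _ _ py.
have := incr _ _ _ _ _ gy fy fx0.
by move: gyr; rewrite gx0 gy fy !lee_fin; lra.
Qed.
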